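(* There is an absolute constant $C$ such that the following holds. For any integer $s\ge 2$ and any query points $x_1,\dots,x_m\in\mathbb{R}^2$ with $m\le s^{1/10}$, if $f\sim D_1$ and $g\sim D_2$, then the distributions of $(f(x_1),\dots,f(x_m))$ and $(g(x_1),\dots,g(x_m))$ are within total variation distance $Cs^{-1/10}$.
   Context: The distributions $D_1,D_2$ over functions $\mathbb{R}^2\to\{-1,1\}$ (depending on $s$): let $\theta\in\mathbb{R}^2$ be a uniformly random unit vector and $\theta^\perp$ its $90^\circ$ clockwise rotation. Choose $a_1,\dots,a_{s-1}$ independently uniformly from $[-1,1]$ and sort them in increasing order; set $a_0=-1$, $a_s=1$. Choose independent uniform random bits $b_1,\dots,b_s\in\{-1,1\}$, and $z$ uniform in $[-1,1]$ independent of everything else. $f\sim D_1$ is defined by $f(x)=b_i$ if $a_{i-1}<\langle x,\theta\rangle\le a_i$ for some $i\in\{1,\dots,s\}$, and $f(x)=1$ otherwise. $g\sim D_2$ is defined by $g(x)=b_i\,\mathrm{sign}(\langle x,\theta^\perp\rangle-z)$ if $a_{i-1}<\langle x,\theta\rangle\le a_i$ for some $i\in\{1,\dots,s\}$, and $g(x)=1$ otherwise. *)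

(* Defs.v *)
From HB Require Import structures.
From mathcomp Require Import all_boot all_order all_algebra.
From mathcomp Require Import all_classical all_reals all_analysis.
From mathcomp Require Import Rstruct Rstruct_topology.
From Stdlib Require Import Rdefinitions.

Set Implicit Arguments.
Unset Strict Implicit.
Unset Printing Implicit Defensive.

Import Order.TTheory GRing.Theory Num.Theory.
Local Open Scope classical_set_scope.
Local Open Scope ring_scope.

Notation R := Rdefinitions.R.

Definition pt := (R * R)%type.

Definition dot (x y : pt) : R := x.1 * y.1 + x.2 * y.2.

Definition theta_of (phi : R) : pt := (cos phi, sin phi).
Definition theta_perp (th : pt) : pt := (th.2, - th.1).

(* sign with values in {-1,1}; convention sign 0 = 1 (a null event) *)
Definition sgn (t : R) : R := if 0 <= t then 1 else -1.

Definition bitv (b : bool) : R := if b then 1 else -1.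

(* breakpoints a_0 = -1 < a_1 <= ... <= a_{s-1} < a_s = 1, where
   a_1..a_{s-1} is the increasingly sorted list of the sampled values *)
Definition breakpoints (a : seq R) : seq R :=
  -1 :: rcons (sort <=%R a) 1.

(* the piece index: Some i (i : 'I_s, standing for the paper's i+1) when
   a_i < t <= a_{i+1} *)
Definition piece (s : nat) (a : seq R) (t : R) : option 'I_s :=
  [pick i : 'I_s | (nth 0 (breakpoints a) i < t) && (t <= nth 0 (breakpoints a) i.+1)].

Definition fD1 (s : nat) (th : pt) (a : seq R) (b : {ffun 'I_s -> bool})
    (x : pt) : R :=
  if piece s a (dot x th) is Some i then bitv (b i) else 1.

Definition gD2 (s : nat) (th : pt) (a : seq R) (b : {ffun 'I_s -> bool})
    (z : R) (x : pt) : R :=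
  if piece s a (dot x th) is Some i
  then bitv (b i) * sgn (dot x (theta_perp th) - z) else 1.

(* Expectation over n independent uniform samples from [-1,1]:
   iterated (normalized) Lebesgue integrals, i.e. integration against the
   n-fold product of the uniform probability on [-1,1]. *)
Fixpoint unif_n (n : nat) (F : seq R -> \bar R) : \bar R :=
  match n with
  | 0 => F [::]
  | n'.+1 =>
    (\int[lebesgue_measure]_(y in `[(-1 : R), (1 : R)]%classic)
       ((2^-1)%:E * unif_n n' (fun l => F (y :: l))))%E
  end.

Definition unif1 (F : R -> \bar R) : \bar R :=
  (\int[lebesgue_measure]_(z in `[(-1 : R), (1 : R)]%classic) ((2^-1)%:E * F z))%E.

Definition unif_circle (F : pt -> \bar R) : \bar R :=
  (\int[lebesgue_measure]_(phi in `[(0 : R), (2 * pi : R)[%classic)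
      (((2 * pi)^-1)%:E * F (theta_of phi)))%E.

Definition unif_bits (s : nat) (F : {ffun 'I_s -> bool} -> \bar R) : \bar R :=
  (((2 ^+ s)^-1)%:E * \sum_(b : {ffun 'I_s -> bool}) F b)%E.

Definition indic (P : bool) : \bar R := (if P then 1 else 0)%E.

Definition signvec (m : nat) (v : {ffun 'I_m -> bool}) (i : 'I_m) : R :=
  bitv (v i).

Definition probD1 (s m : nat) (x : 'I_m -> pt) (v : {ffun 'I_m -> bool})
  : \bar R :=
  unif_circle (fun th => unif_n s.-1 (fun a => unif_bits (fun b : {ffun 'I_s -> bool} =>
    indic [forall i, fD1 th a b (x i) == signvec v i]))).

Definition probD2 (s m : nat) (x : 'I_m -> pt) (v : {ffun 'I_m -> bool})
  : \bar R :=
  unif_circle (fun th => unif_n s.-1 (fun a => unif_bits (fun b : {ffun 'I_s -> bool} =>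
    unif1 (fun z => indic [forall i, gD2 th a b z (x i) == signvec v i])))).

Definition tv_D1_D2 (s m : nat) (x : 'I_m -> pt) : \bar R :=
  ((2^-1)%:E * \sum_(v : {ffun 'I_m -> bool})
      `|probD1 s x v - probD2 s x v|)%E.

(* Main.v *)
Require Import Defs.
From HB Require Import structures.
From mathcomp Require Import all_boot all_order all_algebra.
From mathcomp Require Import all_classical all_reals all_analysis.
From mathcomp Require Import ring lra measurable_realfun.
From mathcomp Require Import Rstruct Rstruct_topology.

(* Fix the direction [theta], the breakpoints and [z], and average over the
   bits only.  If no two queries lying in the same piece are separated by the
   line [<x, theta_perp> = z], then flipping the bits of the pieces seen on the
   negative side is a bijection exchanging the two models, so the answers have
   the same law.  Hence the total variation distance is at most the probability
   that some pair of queries shares a piece and is separated.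
   Write [w] for the difference of two queries and [d] for its l1 norm.
   Separation has probability at most [min 1 d].  If [|<w, theta>| >= tau], none
   of the [s - 1] breakpoints falls between the two projections with probability
   at most [(1 - tau / 2) ^ (s - 1) = O(1 / (s tau))], and [|<w, theta>| < tau]
   has probability [O(tau / d)].  With [tau = s ^ (-1/2)] each pair contributes
   [O(s ^ (-1/2))], and there are at most [s ^ (1/5)] pairs. *)

Set Implicit Arguments.
Unset Strict Implicit.
Unset Printing Implicit Defensive.

Import Order.TTheory GRing.Theory Num.Theory.
Import numFieldNormedType.Exports.
Local Open Scope classical_set_scope.
Local Open Scope ring_scope.

(** * Elementary inequalities *)

Lemma expr1B_le (R : realFieldType) (x : R) n : 0 <= x <= 1 ->
  (1 - x) ^+ n <= (1 + n%:R * x)^-1.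
Proof.
move=> /andP[x0 x1].
have nx0 k : 0 < 1 + k%:R * x by rewrite ltr_pwDl// mulr_ge0.
rewrite -[leRHS]mul1r ler_pdivlMr//; elim: n => [|n IH]; first by rewrite expr0; lra.
apply: le_trans IH; rewrite exprSr -mulrA ler_wpM2l ?exprn_ge0 ?subr_ge0//.
rewrite -natr1 -subr_ge0 (_ : _ - _ = (n%:R + 1) * (x * x)); last by ring.
by rewrite mulr_ge0 ?addr_ge0 ?mulr_ge0.
Qed.

Section Exponents.
Context (R : realType).
Implicit Types s q : R.

Lemma mulr_sqr_powRNhalf s : 0 < s -> s * (s `^ (- 2^-1)) ^+ 2 = 1.
Proof.
move=> s0; rewrite -powR_mulrn ?powR_ge0// -powRrM mulNr mulVf// powR_inv1 ?ltW//.
by rewrite divff// gt_eqF.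
Qed.

Lemma div_powRNhalf_le n : (0 < n)%N ->
  2 / (n%:R * n.+1%:R `^ (- 2^-1)) <= 4 * n.+1%:R `^ (- 2^-1) :> R.
Proof.
move=> n0; have n1 : 1 <= n%:R :> R by rewrite ler1n.
have s0 : 0 < n.+1%:R :> R by rewrite ltr0n.
have tau_sqr := mulr_sqr_powRNhalf s0; have tau0 := powR_gt0 (- 2^-1) s0.
move: (_ `^ _) tau0 tau_sqr => tau tau0; rewrite -natr1 => tau_sqr.
rewrite ler_pdivrMr ?mulr_gt0 ?ltr0n//.
have : 0 <= (n%:R - 1) * tau ^+ 2 by rewrite mulr_ge0 ?sqr_ge0 ?subr_ge0.
by rewrite expr2 in tau_sqr *; lra.
Qed.

Lemma sqr_mul_powRNhalf_le s q : 1 <= s -> 0 <= q -> q <= s `^ (10^-1) ->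
  q ^+ 2 * s `^ (- 2^-1) <= s `^ (- 10^-1).
Proof.
move=> s1 q0 qs.
apply: (@le_trans _ _ ((s `^ 10^-1) ^+ 2 * s `^ (- 2^-1))).
  by rewrite ler_wpM2r ?powR_ge0// lerXn2r// nnegrE powR_ge0.
rewrite -powR_mulrn ?powR_ge0// -powRrM -powRD; last by apply/implyP => _; lra.
by apply: ler_powR => //; lra.
Qed.

End Exponents.

(** * Counting below a threshold *)

Section CountLt.
Context d (T : orderType d).
Implicit Types (s : seq T) (x y : T).
Local Open Scope order_scope.

Lemma count_lt_eq_notin s x y : x <= y -> count (< x) s = count (< y) s ->
  forall z, z \in s -> ~~ (x <= z < y).
Proof.
move=> xy eq_count; apply/allP; rewrite -[all _ _]negbK -has_predC has_count -eqn0Ngt.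
have /eqP := count_predUI (< x) (predC (fun z => ~~ (x <= z < y))) s.
rewrite (@seq.eq_count _ (predI _ _) pred0) => [|z /=]; last first.
  by rewrite negbK; case: ltP.
rewrite (@seq.eq_count _ (predU _ _) (< y)) => [|z /=]; last first.
  by rewrite negbK; case: ltP => //= zx; rewrite (lt_le_trans zx).
by rewrite count_pred0 addn0 eq_count -[X in X == _]addn0 eqn_add2l eq_sym.
Qed.

Lemma nth_lt_count s x0 x i : sorted <=%O s -> (i < size s)%N ->
  (nth x0 s i < x) = (i < count (< x) s)%N.
Proof.
move=> ss si; have [ic|ci] := ltnP i (count (< x) s); first exact: nth_count_lt ic.
by apply/negbTE; rewrite -leNgt; apply: nth_count_ge; rewrite ?ci.
Qed.

End CountLt.

(** * Product measures *)

Section ProductMeasure.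
Context d1 d2 (T1 : measurableType d1) (T2 : measurableType d2) (R : realType).
Local Open Scope ereal_scope.

Section ProductProbability.
Variables (P1 : probability T1 R) (P2 : probability T2 R).

Let product_probability_setT : (P1 \x P2) setT = 1.
Proof.
rewrite -setXTT product_measure1E//.
by rewrite [X in X * _]probability_setT [X in _ * X]probability_setT mule1.
Qed.

HB.instance Definition _ :=
  Measure_isProbability.Build _ _ _ (P1 \x P2) product_probability_setT.

End ProductProbability.

Lemma product_measure1_le_section (m1 : {measure set T1 -> \bar R})
    (m2 : {sigma_finite_measure set T2 -> \bar R}) (A : set (T1 * T2))
    (f : T1 -> \bar R) :
  measurable A -> measurable_fun setT f ->
  (forall x, m2 (xsection A x) <= f x) -> (m1 \x m2) A <= \int[m1]_x f x.
Proof.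
move=> mA mf Af; apply: ge0_le_integral => //.
  exact: measurable_fun_xsection.
by move=> x _; exact: Af.
Qed.

End ProductMeasure.

Lemma integral_cst_prob d (T : measurableType d) (R : realType) (P : probability T R)
    (k : \bar R) : (\int[P]_x k = k)%E.
Proof. by rewrite integral_cst// [X in (_ * X)%E]probability_setT mule1. Qed.

Lemma measure_bigcup_le_card d (T : measurableType d) (R : realType)
    (mu : {measure set T -> \bar R}) (I : finType) (A : I -> set T) (c : R) :
  (forall i, measurable (A i)) -> (forall i, mu (A i) <= c%:E)%E ->
  (mu (\bigcup_i A i) <= (#|I|%:R * c)%:E)%E.
Proof.
move=> mA Ac; have -> : [set: I] = [set` index_enum I].
  by apply/seteqP; split => i //= _; rewrite mem_index_enum.
apply: (@le_trans _ _ (\sum_(i \in [set` index_enum I]) mu (A i))%E).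
  by apply: content_sub_fsum => //; apply: fin_bigcup_measurable.
rewrite -fsbig_seq ?index_enum_uniq//.
apply: (@le_trans _ _ (\sum_(i : I) c%:E)%E); first exact: lee_sum.
by rewrite sumEFin sumr_const mulr_natl.
Qed.

Section PowerProbability.
Context d (T : measurableType d) (R : realType) (P : probability T R).
Local Open Scope ereal_scope.

Definition tcons n (p : T * n.-tuple T) : n.+1.-tuple T := [tuple of p.1 :: p.2].

Lemma measurable_tcons n : measurable_fun setT (@tcons n).
Proof. exact: measurable_cons. Qed.

HB.instance Definition _ n := isMeasurableFun.Build _ _ _ _ _ (@measurable_tcons n).

Fixpoint power_prob n : probability (n.-tuple T) R :=
  match n with
  | 0 => \d_([tuple] : 0.-tuple T)
  | n.+1 => distribution (P \x power_prob n) (@tcons n)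
  end.

Lemma ge0_integral_power_probS n (F : n.+1.-tuple T -> \bar R) :
  measurable_fun setT F -> (forall l, 0 <= F l) ->
  \int[power_prob n.+1]_l F l =
  \int[P]_y \int[power_prob n]_l F (tcons (y, l)).
Proof.
move=> mF F0; rewrite ge0_integral_distribution// fubini_tonelli1//.
- exact: measurableT_comp.
- by move=> p; exact: F0.
Qed.

Lemma measurable_tuple_all n (A : set T) : measurable A ->
  measurable [set l : n.-tuple T | forall i, A (tnth l i)].
Proof.
move=> mA.
rewrite (_ : mkset _ = \bigcap_(i : 'I_n) (@tnth n T ^~ i) @^-1` A).
  apply: fin_bigcap_measurable => // i _; rewrite -[X in measurable X]setTI.
  exact: measurable_tnth.
by apply/seteqP; split => l /= Al i; [move=> _|]; exact: Al.
Qed.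

Lemma power_prob_all n (A : set T) : measurable A ->
  power_prob n [set l : n.-tuple T | forall i, A (tnth l i)] = P A ^+ n.
Proof.
move=> mA; elim: n => [|n IH].
  by rewrite [X in power_prob 0 X](_ : _ = setT) ?probability_setT// -subTset => l _ [].
rewrite expeS -IH -product_measure1E//; last exact: measurable_tuple_all.
congr (product_measure1 _ _ _); apply/seteqP; split => -[y l] /=.
  by move=> Ayl; split => [|i]; [exact: Ayl ord0|have := Ayl (lift ord0 i); rewrite tnthS].
by move=> [Ay Al] i; case: (unliftP ord0 i) => [j|] ->; rewrite ?tnthS.
Qed.

End PowerProbability.

(** * Measurability of functions with countably many values *)

Section MeasurableSelect.
Context d d' (T : measurableType d) (T' : measurableType d').

Lemma measurable_fun_select (U : countType) (f : T -> U) (h : U -> T -> T') :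
  (forall u, measurable_fun setT (fun t => f t == u)) ->
  (forall u, measurable_fun setT (h u)) ->
  measurable_fun setT (fun t => h (f t) t).
Proof.
move=> mf mh _ Y mY; rewrite setTI.
rewrite (_ : _ @^-1` Y = \bigcup_u
    ((fun t => f t == u) @^-1` [set true] `&` h u @^-1` Y)).
  apply: countable_bigcupT_measurable => [|u]; first exact: countableP.
  apply: measurableI.
    by rewrite -[X in measurable X]setTI; exact: mf.
  by rewrite -[X in measurable X]setTI; exact: mh.
apply/seteqP; split => [t Yt|t [u _] [/eqP <-]//].
by exists (f t) => //; split => //=; rewrite eqxx.
Qed.

End MeasurableSelect.

Section MeasurableBool.
Context d (T : measurableType d).
Implicit Types f g : T -> bool.

Lemma measurable_bool_set f : measurable_fun setT f -> measurable [set t | f t].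
Proof. by move=> mf; rewrite -[X in measurable X]setTI; exact: (mf _ [set true]). Qed.

Lemma measurable_fun_natb (R : realType) f :
  measurable_fun setT f -> measurable_fun setT (fun t => (f t)%:R : R).
Proof. by move=> mf; apply: (measurableT_comp (f := fun b : bool => b%:R : R)). Qed.

Lemma measurable_fun_neqb f g : measurable_fun setT f -> measurable_fun setT g ->
  measurable_fun setT (fun t => f t != g t).
Proof.
move=> mf mg; rewrite (_ : (fun _ => _) = fun t => if f t then ~~ g t else g t).
  by apply: measurable_fun_ifT => //; exact: measurable_neg.
by apply/funext => t; case: (f t); case: (g t).
Qed.

Lemma measurable_fun_forall (I : finType) (f : I -> T -> bool) :
  (forall i, measurable_fun setT (f i)) ->
  measurable_fun setT (fun t => [forall i, f i t]).
Proof.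
move=> mf; apply: (measurable_fun_bool true); rewrite setTI.
rewrite (_ : _ @^-1` _ = \bigcap_i [set t | f i t]).
  by apply: fin_bigcap_measurable => // i _; exact: measurable_bool_set.
by apply/seteqP; split => t /= => [/forallP ft i _|ft]; [|apply/forallP => i]; exact: ft.
Qed.

Lemma measurable_fun_count I (s : seq I) (f : I -> T -> bool) :
  (forall i, measurable_fun setT (f i)) ->
  measurable_fun setT (fun t => count (f^~ t) s).
Proof.
move=> mf; elim: s => [|i s IH] //=; apply: measurable_fun_addn => //.
exact: (measurableT_comp (f := nat_of_bool)).
Qed.

End MeasurableBool.

(** * Total variation distance of mixtures *)

Section Pmf.
Context (R : realFieldType) (V : finType).
Implicit Types p q : V -> R.

Definition is_pmf p : Prop := (forall v, 0 <= p v) /\ \sum_v p v = 1.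

Lemma pmf_le1 p v : is_pmf p -> p v <= 1.
Proof. by move=> [p0 <-]; rewrite (bigD1 v)//= lerDl sumr_ge0. Qed.

Lemma sum_dist_pmf_le2 p q : is_pmf p -> is_pmf q -> \sum_v `|p v - q v| <= 2.
Proof.
move=> [p0 p1] [q0 q1]; rewrite -[2]/(1 + 1) -{1}p1 -q1 -big_split ler_sum//= => v _.
by rewrite (le_trans (ler_normB _ _))// !ger0_norm.
Qed.

End Pmf.

Section Mixture.
Context d (T : measurableType d) (R : realType) (P : probability T R) (V : finType).
Implicit Types p q : T -> V -> R.

Lemma integrable_pmf p v : (forall t, is_pmf (p t)) ->
  measurable_fun setT (p^~ v) -> P.-integrable setT (fun t => (p t v)%:E).
Proof.
move=> pmf mp; apply: measurable_bounded_integrable => //.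
  by rewrite [ltLHS]probability_setT ltry.
exists 1; split=> // M M1 t _ /=; rewrite ger0_norm ?(proj1 (pmf t))//.
by rewrite (le_trans (pmf_le1 v (pmf t)))// ltW.
Qed.

Lemma tv_mixture_le p q (B : set T) :
  (forall t, is_pmf (p t)) -> (forall v, measurable_fun setT (p^~ v)) ->
  (forall t, is_pmf (q t)) -> (forall v, measurable_fun setT (q^~ v)) ->
  measurable B -> (forall t v, ~ B t -> p t v = q t v) ->
  ((2^-1)%:E * \sum_v `|\int[P]_t (p t v)%:E - \int[P]_t (q t v)%:E| <= P B)%E.
Proof.
move=> pmfp mp pmfq mq mB pq.
have mnorm v : measurable_fun setT (fun t => `|p t v - q t v|%:E).
  by apply/measurable_EFinP; apply: measurableT_comp => //; exact: measurable_funB.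
apply: (@le_trans _ _ ((2^-1)%:E * \int[P]_t (\sum_v `|p t v - q t v|%:E))%E).
  rewrite lee_wpmul2l ?lee_fin// ge0_integral_sum//.
  apply: lee_sum => v _; rewrite -integralB_EFin//; try exact: integrable_pmf.
  apply: (le_abse_integral P) => //; apply/measurable_EFinP; exact: measurable_funB.
have -> : (P B = (2^-1)%:E * \int[P]_t (2 * \1_B t)%:E)%E.
  under eq_integral do rewrite EFinM.
  rewrite ge0_integralZl//; last exact/measurable_EFinP.
  by rewrite integral_indic// setIT muleA -EFinM mulVf// mul1e.
rewrite lee_wpmul2l ?lee_fin//; apply: ge0_le_integral => //.
- by move=> t _; rewrite sume_ge0.
- exact: emeasurable_sum.
- by apply/measurable_EFinP; exact: measurable_funM.
- move=> t _; rewrite sumEFin lee_fin indicE.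
  have [_|tB] := boolP (t \in B); first by rewrite mulr1 sum_dist_pmf_le2.
  rewrite mulr0 big1// => v _; rewrite pq ?subrr ?normr0//.
  by move/mem_set; exact/negP.
Qed.

End Mixture.

(** * Averaging over the random bits *)

Section Answer.
Variables (I J : finType) (F : realFieldType).
Implicit Types (K : I -> option J) (S : I -> bool) (b : {ffun J -> bool}).
Implicit Type v : {ffun I -> bool}.

(* [k = None] stands for the points outside all pieces, [s] for the truth value
   of [<x, theta_perp> >= z]. *)
Definition answer b (k : option J) (s : bool) : bool :=
  if k is Some j then b j (+) ~~ s else true.

Definition answer_pmf K S v : F :=
  (2 ^+ #|J|)^-1 * \sum_b [forall i, answer b (K i) (S i) == v i]%:R.

Definition clash K S i j : bool :=
  [&& K i != None, K i == K j & S i != S j].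

Lemma is_pmf_answer_pmf K S : is_pmf (answer_pmf K S).
Proof.
split=> [v|]; first by rewrite mulr_ge0 ?sumr_ge0// invr_ge0 exprn_ge0.
rewrite -mulr_sumr exchange_big /= (eq_bigr (fun=> 1)) => [|b _].
  by rewrite sumr_const card_ffun card_bool natrX mulVf// expf_neq0.
rewrite (bigD1 [ffun i => answer b (K i) (S i)])//= big1 ?addr0 => [|v].
  by case: forallP => // -[] i; rewrite ffunE.
apply: contraNeq; rewrite pnatr_eq0 eqb0 negbK => /forallP bv.
by apply/eqP/ffunP => i; rewrite ffunE (eqP (bv i)).
Qed.

Lemma answer_pmf_no_clash K S v : (forall i j, ~~ clash K S i j) ->
  answer_pmf K S v = answer_pmf K xpredT v.
Proof.
move=> noclash.
pose side k := if [pick i | K i == Some k] is Some i then S i else true.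
have sideE i k : K i = Some k -> side k = S i.
  move=> Ki; rewrite /side; case: pickP => [j /eqP Kj|/(_ i)]; last by rewrite Ki eqxx.
  by have := noclash j i; rewrite /clash Ki Kj eqxx/= negbK => /eqP.
pose flip b : {ffun J -> bool} := [ffun k => b k (+) ~~ side k].
have flipK : involutive flip by move=> b; apply/ffunP => k; rewrite !ffunE addbK.
rewrite /answer_pmf (reindex_inj (inv_inj flipK)); congr (_ * _).
apply: eq_bigr => b _; congr (nat_of_bool _)%:R; apply: eq_forallb => i; congr (_ == _).
by rewrite /answer; case Ki: (K i) => [k|//]; rewrite ffunE (sideE i)// addbK addbF.
Qed.

End Answer.

Section MeasurableAnswer.
Context d (T : measurableType d) (I J : finType) (R : realType).
Variables (K : T -> I -> option J) (S : T -> I -> bool).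
Hypotheses (mK : forall i k, measurable_fun setT (fun t => K t i == k))
  (mS : forall i, measurable_fun setT (S^~ i)).

Lemma measurable_answer_eq b v :
  measurable_fun setT (fun t => [forall i, answer b (K t i) (S t i) == v i]).
Proof.
apply: measurable_fun_forall => i.
apply: (measurable_fun_select (h := fun k t => answer b k (S t i) == v i)) => // k.
exact: (measurableT_comp (f := fun s => answer b k s == v i)).
Qed.

Lemma measurable_answer_pmf v :
  measurable_fun setT (fun t => answer_pmf R (K t) (S t) v).
Proof.
apply: measurable_funM => //; apply: measurable_sum => b.
by apply: measurable_fun_natb; exact: measurable_answer_eq.
Qed.

Lemma integral_answer_pmf (mu : {measure set T -> \bar R}) v :
  (\int[mu]_t (answer_pmf R (K t) (S t) v)%:E = ((2 ^+ #|J|)^-1)%:E *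
    \sum_b \int[mu]_t [forall i, answer b (K t i) (S t i) == v i]%:R%:E)%E.
Proof.
have mans b : measurable_fun setT
    (fun t => ([forall i, answer b (K t i) (S t i) == v i]%:R : R)%:E).
  by apply/measurable_EFinP; apply: measurable_fun_natb; exact: measurable_answer_eq.
rewrite -ge0_integral_sum// -ge0_integralZl//.
- by apply: eq_integral => t _; rewrite sumEFin -EFinM.
- exact: emeasurable_sum.
- by move=> t _; exact: sume_ge0.
Qed.

Lemma measurable_clash i j : measurable [set t | clash (K t) (S t) i j].
Proof.
apply: measurable_bool_set; rewrite /clash.
apply: (measurable_fun_select
  (h := fun k t => [&& k != None, k == K t j & S t i != S t j])) => // k.
do 2 apply: measurable_and => //; last exact: measurable_fun_neqb.
by under eq_fun do rewrite eq_sym; exact: mK.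
Qed.

End MeasurableAnswer.

(** * Lebesgue measure and uniform distributions *)

Lemma lebesgue_measure_itv_bnd (R : realType) (l r : bool) (a b : R) : a <= b ->
  lebesgue_measure [set` Interval (BSide l a) (BSide r b)] = (b - a)%:E.
Proof.
rewrite lebesgue_measure_itv /= lte_fin le_eqVlt => /orP[/eqP->|->]; last by rewrite EFinB.
by rewrite ltxx subrr.
Qed.

Section UniformProb.
Context (R : realType) (a b : R) (ab : a < b).
Local Notation mu := (@lebesgue_measure R).

Lemma uniform_probE (A : set R) : measurable A ->
  (uniform_prob ab A = ((b - a)^-1)%:E * mu (A `&` `[a, b]))%E.
Proof.
move=> mA; rewrite -[in LHS](setIT A) -integral_indic// integral_uniform//.
- by rewrite integral_indic.
- exact/measurable_EFinP.
Qed.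

End UniformProb.

Section LocallySmall.
Context (R : realType).
Local Notation mu := (@lebesgue_measure R).

Lemma lebesgue_measure_locally_small (N : nat) (D : R) (A : set R) :
  measurable A -> 0 <= D -> A `<=` `[0, N%:R[ ->
  (forall x y, A x -> A y -> `|x - y| <= 1 -> `|x - y| <= D) ->
  (mu A <= (N%:R * (2 * D))%:E)%E.
Proof.
move=> mA D0 AN small.
have /choice[c cE] (k : nat) : exists c : R, forall x, A x -> Num.truncn x = k ->
    0 <= x -> `|c - x| <= D.
  have [[c [Ac c0 ck]]|noA] := pselect (exists c, [/\ A c, 0 <= c & Num.truncn c = k]).
    exists c => x Ax xk x0; apply: small => //.
    have := truncn_itv c0; have := truncn_itv x0; rewrite xk ck -natr1.
    by move=> /andP[? ?] /andP[? ?]; rewrite ler_norml; apply/andP; split; lra.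
  by exists 0 => x Ax xk x0; case: noA; exists x.
pose J k : set R := `[c k - D, c k + D]%classic.
have muJ k : mu (J k) = (2 * D)%:E.
  by rewrite lebesgue_measure_itv_bnd; [congr EFin; ring|lra].
apply: (@le_trans _ _ (\sum_(k < N) mu (J k))%E).
  apply: content_subadditive => // [k _|x Ax]; first exact: measurable_itv.
  have := AN _ Ax; rewrite /= in_itv/= => /andP[x0 xN].
  have kN : (Num.truncn x < N)%N by rewrite truncn_lt_nat.
  rewrite -bigcup_mkord; exists (Num.truncn x) => //=.
  by rewrite /J/= in_itv/= -ler_distl distrC; exact: cE.
under eq_bigr do rewrite muJ.
by rewrite sumEFin lee_fin sumr_const card_ord [leRHS]mulr_natl.
Qed.

End LocallySmall.

(** * Directions almost orthogonal to a given vector *)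

Section Strip.
Context (R : realType).
Implicit Types (w : R * R) (phi psi tau : R).

Definition proj w phi : R := w.1 * cos phi + w.2 * sin phi.

Definition rot w : R * R := (- w.2, w.1).

Definition norm1 w : R := `|w.1| + `|w.2|.

Definition strip w tau : set R := [set phi | `|proj w phi| < tau].

Lemma projB w w' phi : proj (w - w') phi = proj w phi - proj w' phi.
Proof. by rewrite /proj/=; ring. Qed.

Lemma proj_rot w phi : proj (rot w) phi = w.1 * sin phi + w.2 * - cos phi.
Proof. by rewrite /proj/=; ring. Qed.

Lemma rotB w w' : rot (w - w') = rot w - rot w'.
Proof. by congr pair; rewrite opprD. Qed.

Lemma norm1_rot w : norm1 (rot w) = norm1 w.
Proof. by rewrite /norm1/= normrN addrC. Qed.

Lemma norm1_ge0 w : 0 <= norm1 w. Proof. exact: addr_ge0. Qed.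

Lemma norm_proj_le w phi : `|proj w phi| <= norm1 w.
Proof.
apply: le_trans (ler_normD _ _) _; rewrite !normrM.
by apply: lerD; rewrite ler_piMr ?cos_max ?sin_max.
Qed.

Lemma measurable_proj w : measurable_fun setT (proj w).
Proof.
apply: measurable_funD; apply: measurable_funM => //; apply: continuous_measurable_fun.
- exact: continuous_cos.
- exact: continuous_sin.
Qed.

Lemma measurable_strip w tau : measurable (strip w tau).
Proof.
apply: measurable_bool_set; apply: measurable_fun_ltr => //.
by apply: measurableT_comp => //; exact: measurable_proj.
Qed.

Lemma sin_ge_cos1M (x : R) : 0 <= x <= 1 -> cos 1 * x <= sin x.
Proof.
move=> /andP[x0 x1].
have [|c] := @MVT_segment R sin cos 0 x x0 (fun y _ => is_derive_sin y).
  by apply/continuous_subspaceT => ?; exact: continuous_sin.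
rewrite in_itv /= sin0 !subr0 => /andP[c0 cx] ->; rewrite ler_wpM2r//.
have [->//|c1] := eqVneq c 1; rewrite ltW// ltr_cos ?lt_neqAle ?c1 ?(le_trans cx)//.
  by rewrite in_itv/=; have := pi_ge2 R; lra.
by rewrite in_itv/=; have := pi_ge2 R; lra.
Qed.

Lemma norm_sin_ge_cos1M (x : R) : `|x| <= 1 -> cos 1 * `|x| <= `|sin x|.
Proof.
move=> x1; have := @sin_ge_cos1M `|x|; rewrite normr_ge0 x1 => /(_ isT) /le_trans; apply.
have [_|_] := ger0P x; first exact: ler_norm.
by rewrite sinN -normrN ler_norm.
Qed.

(* By the addition formulas, the coordinates of [sin (psi - phi) *: w] are
   combinations of the two projections with coefficients bounded by 1. *)
Lemma strip_locally_small w tau phi psi : strip w tau phi -> strip w tau psi ->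
  `|psi - phi| <= 1 -> norm1 w * (cos 1 * `|psi - phi|) <= 4 * tau.
Proof.
move=> phitau psitau close.
apply: (@le_trans _ _ (norm1 w * `|sin (psi - phi)|)).
  by rewrite ler_wpM2l ?norm1_ge0// norm_sin_ge_cos1M.
have combination_le (a b x y : R) : `|a| <= 1 -> `|b| <= 1 -> `|x| < tau -> `|y| < tau ->
    `|a * x - b * y| <= 2 * tau.
  move=> a1 b1 /ltW xtau /ltW ytau; rewrite mulr_natl mulr2n.
  apply: le_trans (ler_normB _ _) _; rewrite !normrM.
  by apply: lerD; [apply: le_trans xtau|apply: le_trans ytau]; rewrite ler_piMl.
rewrite /norm1 mulrDl -!normrM.
have -> : w.1 * sin (psi - phi) = sin psi * proj w phi - sin phi * proj w psi.
  by rewrite sinB /proj; ring.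
have -> : w.2 * sin (psi - phi) = cos phi * proj w psi - cos psi * proj w phi.
  by rewrite sinB /proj; ring.
rewrite (_ : 4 * tau = 2 * tau + 2 * tau); last by ring.
by apply: lerD; apply: combination_le; rewrite ?cos_max ?sin_max.
Qed.

Lemma two_pi_gt0 : 0 < 2 * pi :> R.
Proof. by rewrite mulr_gt0// pi_gt0. Qed.

Lemma uniform_prob_strip_le w tau : 0 < tau -> 0 < norm1 w ->
  (uniform_prob two_pi_gt0 (strip w tau) <= (64 / cos 1 * tau / norm1 w)%:E)%E.
Proof.
move=> tau0 w0; have c0 := cos1_gt0 R; have pi2 := pi_ge2 R.
pose D := 4 * tau / (norm1 w * cos 1).
have D0 : 0 <= D by rewrite divr_ge0 ?mulr_ge0 // ltW // mulr_gt0.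
rewrite uniform_probE; last exact: measurable_strip.
apply: (@le_trans _ _ (8%:R * (2 * D))%:E).
  rewrite -[leRHS]mul1e; apply: lee_pmul => //; first by rewrite lee_fin invr_ge0; lra.
    by rewrite lee_fin invf_le1; lra.
  apply: lebesgue_measure_locally_small => //.
  - by apply: measurableI => //; exact: measurable_strip.
  - move=> phi [_]; rewrite /= !in_itv/= => /andP[-> phi2pi].
    by have := pihalf_lt2 R; lra.
  - move=> psi phi [psitau _] [phitau _] close.
    rewrite /D ler_pdivlMr ?mulr_gt0// mulrC -mulrA.
    exact: strip_locally_small.
rewrite lee_fin /D le_eqVlt; apply/orP; left; apply/eqP; field.
by rewrite !gt_eqF.
Qed.

End Strip.

(** * Pieces and sides *)

Section Piece.
Context (R : realType).
Implicit Types (l : seq R) (t u : R).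

(* [piece] computed by counting instead of sorting, so as to be measurable in the
   breakpoints. *)
Definition cell n l t : option 'I_n.+1 :=
  if -1 < t <= 1 then Some (inord (count (< t) l)) else None.

Definition same_cell n l t u : bool :=
  (cell n l t != None) && (cell n l t == cell n l u).

Lemma same_cellC n l t u : same_cell n l t u = same_cell n l u t.
Proof.
rewrite /same_cell; have [->//|_] := eqVneq (cell n l t) (cell n l u).
by rewrite !andbF.
Qed.

Lemma same_cell_notin n l t u : size l = n -> t <= u -> same_cell n l t u ->
  [/\ -1 < t, u <= 1 & forall y, y \in l -> ~~ (t <= y < u)].
Proof.
move=> ln tu; rewrite /same_cell /cell; case: ifP => // /andP[t1 _].
case: ifP => // /andP[_ u1] /eqP[].
move=> /(congr1 val); rewrite /= !inordK ?ltnS -?ln ?count_size// => ctu.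
by split => //; exact: count_lt_eq_notin.
Qed.

Lemma measurable_cell d (T : measurableType d) n (l : T -> n.-tuple R) (t : T -> R) k :
  measurable_fun setT l -> measurable_fun setT t ->
  measurable_fun setT (fun w => cell n (l w) (t w) == k).
Proof.
move=> ml mt.
have mcount : measurable_fun setT (fun w => count (< t w) (l w)).
  under eq_fun do rewrite -(map_tnth_enum (l _)) count_map.
  apply: measurable_fun_count => i; apply: measurable_fun_ltr => //.
  exact: (measurableT_comp (measurable_tnth i)).
under eq_fun do rewrite /cell (fun_if (eq_op^~ k)).
apply: measurable_fun_ifT => //.
  by apply: measurable_and; [exact: measurable_fun_ltr|exact: measurable_fun_ler].
exact: (measurableT_comp (f := fun c => Some (inord c) == k :> option 'I_n.+1)).
Qed.

Lemma measurable_same_cell d (T : measurableType d) n (l : T -> n.-tuple R) (t u : T -> R) :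
  measurable_fun setT l -> measurable_fun setT t -> measurable_fun setT u ->
  measurable [set w | same_cell n (l w) (t w) (u w)].
Proof.
move=> ml mt mu; apply: measurable_bool_set; apply: measurable_and.
  by apply: measurable_neg; exact: measurable_cell.
apply: (measurable_fun_select (h := fun k w => k == cell n (l w) (u w))) => k.
  exact: measurable_cell.
by under eq_fun do rewrite eq_sym; exact: measurable_cell.
Qed.

End Piece.

Section Uniform11.
Context (R : realType).
Local Notation mR := (measurableTypeR R).
Implicit Types (p q t u tau : R).

Definition uniform11 : probability mR R := uniform_prob (gtrN (@ltr01 R)).

Lemma uniform11E (A : set mR) : measurable A ->
  (uniform11 A = (2^-1)%:E * lebesgue_measure (A `&` `[(-1)%R, 1%R]))%E.
Proof. by move=> mA; rewrite [LHS]uniform_probE// opprK. Qed.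

Lemma uniform11_itvco t u : -1 <= t -> t <= u -> u <= 1 ->
  uniform11 `[t, u[%classic = ((u - t) / 2)%:E.
Proof.
move=> t1 tu u1; rewrite uniform11E//.
rewrite (_ : _ `&` _ = `[t, u[%classic); last first.
  apply/seteqP; split => y [] //=; rewrite !in_itv/= => /andP[ty yu].
  by split; rewrite ?in_itv/= ?ty ?yu// (le_trans t1)// (le_trans (ltW yu)).
by rewrite lebesgue_measure_itv_bnd// mulrC EFinM.
Qed.

Lemma power_prob_avoid_itv_le n t u : -1 <= t -> t <= u -> u <= 1 ->
  (power_prob uniform11 n [set l | forall i, (~` `[t, u[%classic) (tnth l i)] <=
    ((1 + n%:R * ((u - t) / 2))^-1)%:E)%E.
Proof.
move=> t1 tu u1; have mtu : measurable (~` `[t, u[%classic : set mR).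
  exact: measurableC.
rewrite power_prob_all// probability_setC// uniform11_itvco// -EFinB -EFin_expe.
by rewrite lee_fin expr1B_le//; apply/andP; split; lra.
Qed.

Lemma power_prob_same_cell_le n t u tau : (0 < n)%N -> 0 < tau -> tau <= `|t - u| ->
  (power_prob uniform11 n [set l | same_cell n l t u] <= (2 / (n%:R * tau))%:E)%E.
Proof.
move=> n0 tau0; wlog tu : t u / t <= u => [th|].
  have [/th //|/ltW/th] := leP t u; rewrite distrC.
  by under eq_set do rewrite same_cellC.
rewrite distrC ger0_norm ?subr_ge0// => tautu.
have e0 : 0 < 2 / (n%:R * tau) by rewrite divr_gt0 ?mulr_gt0 ?ltr0n.
have [/andP[t1 u1]|tu1] := boolP ((-1 < t) && (u <= 1)); last first.
  rewrite [X in power_prob _ _ X](_ : _ = set0) ?measure0 ?lee_fin ?(ltW e0)//.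
  apply/seteqP; split => l //= /(same_cell_notin (size_tuple l) tu)[t1 u1 _].
  by rewrite t1 u1 in tu1.
apply: (@le_trans _ _ (power_prob uniform11 n
    [set l | forall i, (~` `[t, u[%classic) (tnth l i)])).
  apply: le_measure; rewrite ?inE.
  - exact: measurable_same_cell.
  - by apply: measurable_tuple_all; exact: measurableC.
  - move=> l /= /(same_cell_notin (size_tuple l) tu)[_ _ tu_avoid] i /=.
    by rewrite in_itv/=; apply/negP/tu_avoid/mem_tnth.
apply: (le_trans (power_prob_avoid_itv_le n (ltW t1) tu u1)); rewrite lee_fin.
have nu0 : 0 <= n%:R * ((u - t) / 2) by rewrite mulr_ge0//; lra.
rewrite -[leRHS]invrK invf_div lef_pV2 ?posrE ?ltr_pwDl ?divr_gt0 ?mulr_gt0 ?ltr0n//.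
by rewrite -[leLHS]add0r lerD// -mulrA ler_wpM2l//; lra.
Qed.

Definition separated p q : set mR := [set z | (0 <= p - z) != (0 <= q - z)].

Lemma separatedC p q : separated p q = separated q p.
Proof. by apply/seteqP; split => z; rewrite /separated/= eq_sym. Qed.

Lemma measurable_separated p q : measurable (separated p q).
Proof.
apply: measurable_bool_set; apply: measurable_fun_neqb;
  by apply: measurable_fun_ler => //; exact: measurable_funB.
Qed.

Lemma uniform11_separated_le p q :
  (uniform11 (separated p q) <= (Num.min 1 `|p - q|)%:E)%E.
Proof.
have mpq := measurable_separated.
rewrite EFin_min le_min probability_le1//=.
wlog pq : p q / p <= q => [th|].
  by have [/th //|/ltW/th] := leP p q; rewrite separatedC distrC.
rewrite uniform11E// distrC ger0_norm ?subr_ge0//.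
apply: (@le_trans _ _ (1 * lebesgue_measure `[p, q]%classic)%E); last first.
  by rewrite mul1e lebesgue_measure_itv_bnd.
apply: lee_pmul => //; first by rewrite lee_fin; lra.
apply: le_measure; rewrite ?inE//; first exact: measurableI.
move=> z [+ _]; rewrite /separated/= in_itv/= !subr_ge0.
by case: (leP z p) => zp; [rewrite (le_trans zp pq)|case: (leP z q) => // _; rewrite ltW].
Qed.

End Uniform11.

Arguments uniform11 {R}.

(** * The probability that two queries clash *)

(* A sample is an angle with the breakpoints, followed by the offset [z]. *)
Local Notation setting R n := (measurableTypeR R * n.-tuple (measurableTypeR R))%type.
Local Notation sample R n := (setting R n * measurableTypeR R)%type.

Section Sample.
Context (R : realType) (n : nat) (I : finType) (x : I -> R * R).
Local Notation mR := (measurableTypeR R).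
Implicit Types (l : seq R) (phi z tau : R).

Definition angle_prob : probability mR R := uniform_prob (@two_pi_gt0 R).

Definition sample_prob : probability (sample R n) R :=
  ((angle_prob \x power_prob uniform11 n) \x uniform11)%E.

Section Tonelli.
Variable f : sample R n -> \bar R.
Hypotheses (mf : measurable_fun setT f) (f0 : forall w, (0 <= f w)%E).

Let measurable_integral_snd :
  measurable_fun setT (fun p : setting R n => \int[uniform11]_z f (p, z))%E.
Proof. exact: measurable_fun_fubini_tonelli_F. Qed.

Let integral_snd_ge0 (p : setting R n) : (0 <= \int[uniform11]_z f (p, z))%E.
Proof. exact: integral_ge0. Qed.

Lemma measurable_integral_side phi :
  measurable_fun setT (fun l : n.-tuple mR => \int[uniform11]_z f ((phi, l), z))%E.
Proof. exact: (measurableT_comp measurable_integral_snd (pair1_measurable phi)). Qed.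

Lemma measurable_integral_breakpoints_side :
  measurable_fun setT (fun phi : mR =>
    \int[power_prob uniform11 n]_l \int[uniform11]_z f ((phi, l), z))%E.
Proof. exact: (measurable_fun_fubini_tonelli_F _ measurable_integral_snd). Qed.

Lemma ge0_integral_sample_prob :
  (\int[sample_prob]_w f w = \int[angle_prob]_phi
    \int[power_prob uniform11 n]_l \int[uniform11]_z f ((phi, l), z))%E.
Proof. by rewrite !fubini_tonelli1. Qed.

End Tonelli.

Definition pieces phi l i : option 'I_n.+1 := cell n l (proj (x i) phi).
Definition sides phi z i : bool := 0 <= proj (rot (x i)) phi - z.

Lemma measurable_pieces i k :
  measurable_fun setT
    (fun w : sample R n => pieces w.1.1 w.1.2 i == k).
Proof.
apply: measurable_cell; first exact: (measurableT_comp measurable_snd).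
by apply: (measurableT_comp (measurable_proj _)); exact: (measurableT_comp measurable_fst).
Qed.

Lemma measurable_sides i :
  measurable_fun setT (fun w : sample R n => sides w.1.1 w.2 i).
Proof.
apply: measurable_fun_ler => //; apply: measurable_funB => //.
by apply: (measurableT_comp (measurable_proj _)); exact: (measurableT_comp measurable_fst).
Qed.

Definition clash_event i j : set (sample R n) :=
  [set w : sample R n | clash (pieces w.1.1 w.1.2) (sides w.1.1 w.2) i j].

Lemma measurable_clash_event i j : measurable (clash_event i j).
Proof.
by apply: measurable_clash => *; [exact: measurable_pieces|exact: measurable_sides].
Qed.

Definition share_event i j : set (setting R n) :=
  [set p : setting R n | same_cell n p.2 (proj (x i) p.1) (proj (x j) p.1)].

Lemma measurable_share_event i j : measurable (share_event i j).
Proof.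
by apply: measurable_same_cell => //; apply: (measurableT_comp (measurable_proj _)).
Qed.

Lemma prob_share_le i j tau : (0 < n)%N -> 0 < tau ->
  ((angle_prob \x power_prob uniform11 n) (share_event i j) <=
    angle_prob (strip (x i - x j)%R tau) + (2 / (n%:R * tau))%:E)%E.
Proof.
move=> n0 tau0; have e0 : 0 <= 2 / (n%:R * tau) by rewrite divr_ge0 ?mulr_ge0 ?(ltW tau0).
have mS := measurable_strip (x i - x j) tau.
have mI : measurable_fun setT (fun phi : mR => (\1_(strip (x i - x j) tau) phi : R)%:E).
  exact/measurable_EFinP.
have -> : (angle_prob (strip (x i - x j)%R tau) + (2 / (n%:R * tau))%:E =
  \int[angle_prob]_phi ((\1_(strip (x i - x j)%R tau) phi)%:E + (2 / (n%:R * tau))%:E))%E.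
  by rewrite ge0_integralD// integral_cst_prob integral_indic ?setIT.
apply: product_measure1_le_section; first exact: measurable_share_event.
  exact: emeasurable_funD.
move=> phi; rewrite (_ : xsection _ _ =
    [set l : n.-tuple mR | same_cell n l (proj (x i) phi) (proj (x j) phi)]); last first.
  by apply/seteqP; split => l; rewrite /xsection/= inE.
rewrite indicE; have [_|/negP phitau] := boolP (phi \in _).
  rewrite (le_trans (probability_le1 _ _))// ?leeDl ?lee_fin//.
  exact: measurable_same_cell.
rewrite add0e; apply: power_prob_same_cell_le => //.
by rewrite -projB leNgt; apply/negP => /mem_set.
Qed.

Lemma prob_clash_le_share i j :
  (sample_prob (clash_event i j) <= (Num.min 1 (norm1 (x i - x j)%R))%:E *
    (angle_prob \x power_prob uniform11 n) (share_event i j))%E.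
Proof.
set d := Num.min _ _.
have mI : measurable_fun setT (fun p => (\1_(share_event i j) p : R)%:E).
  by apply/measurable_EFinP/measurable_indic; exact: measurable_share_event.
have d0 : 0 <= d by rewrite le_min ler01 norm1_ge0.
rewrite -[share_event i j]setIT -integral_indic//; last exact: measurable_share_event.
rewrite -ge0_integralZl//.
apply: product_measure1_le_section; first exact: measurable_clash_event.
  exact: measurable_funeM.
move=> [phi l]; rewrite indicE.
have [share|/negP share] := boolP ((phi, l) \in _); last first.
  rewrite mule0 (_ : xsection _ _ = set0) ?measure0//; apply/seteqP; split => z //=.
  rewrite /xsection/= inE => /and3P[phil_cell same _]; case: share.
  by rewrite inE/=; apply/andP.
rewrite mule1; pose sep := separated (proj (rot (x i)) phi) (proj (rot (x j)) phi).
apply: (@le_trans _ _ (uniform11 sep)).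
  apply: le_measure; rewrite ?inE; last 1 first.
  - by move=> z; rewrite /xsection/= inE => /and3P[].
  - by apply: measurable_xsection; exact: measurable_clash_event.
  - exact: measurable_separated.
apply: (le_trans (uniform11_separated_le _ _)); rewrite lee_fin le_min !ge_min lexx/=.
by rewrite -projB -rotB -norm1_rot norm_proj_le orbT.
Qed.

Lemma prob_clash_le i j tau : (0 < n)%N -> 0 < tau ->
  (sample_prob (clash_event i j) <= (64 / cos 1 * tau + 2 / (n%:R * tau))%:E)%E.
Proof.
move=> n0 tau0; apply: (le_trans (prob_clash_le_share i j)).
set d := norm1 _.
have e0 : 0 <= 2 / (n%:R * tau) by rewrite divr_ge0 ?mulr_ge0 ?(ltW tau0).
have K0 : 0 <= 64 / cos 1 * tau by rewrite mulr_ge0 ?divr_ge0// ltW// cos1_gt0.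
have [d0|d0] := eqVneq d 0.
  by rewrite d0 min_r// mul0e lee_fin addr_ge0.
have {}d0 : 0 < d by rewrite lt_neqAle eq_sym d0 norm1_ge0.
have min0 : 0 <= Num.min 1 d by rewrite le_min ler01 ltW.
apply: (@le_trans _ _ ((Num.min 1 d)%:E *
    (64 / cos 1 * tau / d + 2 / (n%:R * tau))%:E)%E).
  rewrite lee_wpmul2l ?lee_fin// EFinD (le_trans (prob_share_le i j n0 tau0))//.
  by rewrite leeD2r//; exact: uniform_prob_strip_le.
rewrite -EFinM lee_fin mulrDr lerD//; last by rewrite ler_piMl// ge_min lexx.
by rewrite mulrCA ler_piMr// ler_pdivrMr// mul1r ge_min lexx orbT.
Qed.

End Sample.

Section TotalVariation.
Context (R : realType) (n : nat) (I : finType) (x : I -> R * R).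
Local Notation mR := (measurableTypeR R).

Definition lawD1 (w : sample R n) : {ffun I -> bool} -> R :=
  answer_pmf R (pieces n x w.1.1 w.1.2) xpredT.

Definition lawD2 (w : sample R n) : {ffun I -> bool} -> R :=
  answer_pmf R (pieces n x w.1.1 w.1.2) (sides x w.1.1 w.2).

Lemma is_pmf_lawD1 w : is_pmf (lawD1 w). Proof. exact: is_pmf_answer_pmf. Qed.

Lemma is_pmf_lawD2 w : is_pmf (lawD2 w). Proof. exact: is_pmf_answer_pmf. Qed.

Lemma measurable_lawD1 v : measurable_fun setT (lawD1^~ v).
Proof.
by apply: (measurable_answer_pmf (S := fun=> xpredT)) => //; exact: measurable_pieces.
Qed.

Lemma measurable_lawD2 v : measurable_fun setT (lawD2^~ v).
Proof.
by apply: measurable_answer_pmf => *; [exact: measurable_pieces|exact: measurable_sides].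
Qed.

Section FixedLine.
Variables (phi : R) (l : n.-tuple mR) (v : {ffun I -> bool}).

Let measurable_pieces_cst i k : measurable_fun setT (fun _ : mR => pieces n x phi l i == k).
Proof. exact: measurable_cst. Qed.

Let measurable_sides_section i : measurable_fun setT (fun z : mR => sides x phi z i).
Proof. by apply: measurable_fun_ler => //; exact: measurable_funB. Qed.

Lemma measurable_answer_section b : measurable_fun setT
  (fun z : mR => [forall i, answer b (pieces n x phi l i) (sides x phi z i) == v i]).
Proof. exact: (measurable_answer_eq (K := fun=> pieces n x phi l)). Qed.

Lemma integral_lawD2_section :
  (\int[uniform11]_z (lawD2 ((phi, l), z) v)%:E = ((2 ^+ n.+1)^-1)%:E * \sum_b
    \int[uniform11]_z
      [forall i, answer b (pieces n x phi l i) (sides x phi z i) == v i]%:R%:E)%E.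
Proof.
by rewrite (integral_answer_pmf (K := fun=> pieces n x phi l)) ?card_ord.
Qed.

End FixedLine.

Lemma tv_laws_le tau : (0 < n)%N -> 0 < tau ->
  ((2^-1)%:E * \sum_v `|\int[sample_prob R n]_w (lawD1 w v)%:E -
                        \int[sample_prob R n]_w (lawD2 w v)%:E|
    <= (#|I|%:R ^+ 2 * (64 / cos 1 * tau + 2 / (n%:R * tau)))%:E)%E.
Proof.
move=> n0 tau0; pose B : set (sample R n) := \bigcup_ij clash_event x ij.1 ij.2.
have mB : measurable B.
  by apply: fin_bigcup_measurable => // ij _; exact: measurable_clash_event.
apply: (@le_trans _ _ (sample_prob R n B)).
  apply: tv_mixture_le => //.
  - exact: is_pmf_lawD1.
  - exact: measurable_lawD1.
  - exact: is_pmf_lawD2.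
  - exact: measurable_lawD2.
  - move=> w v noclash; apply/esym/answer_pmf_no_clash => i j; apply/negP => ij.
    by apply: noclash; exists (i, j).
rewrite expr2 -natrM -card_prod; apply: measure_bigcup_le_card => -[i j].
  exact: measurable_clash_event.
exact: prob_clash_le.
Qed.

End TotalVariation.

(** * The two distributions *)

Local Notation mR := (measurableTypeR R).

Definition in_box (l : seq R) : Prop := forall y, y \in l -> -1 <= y <= 1.

Lemma unif1E (F : R -> \bar R) (G : mR -> \bar R) :
  (forall y, -1 <= y <= 1 -> F y = G y) ->
  measurable_fun setT G -> (forall y, 0 <= G y)%E ->
  unif1 F = (\int[uniform11]_y G y)%E.
Proof.
move=> FG mG G0; rewrite [RHS]integral_uniform// -ge0_integralZl//.
  by apply: eq_integral => y; rewrite inE/= in_itv/= => /FG ->; rewrite opprK.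
exact: measurable_funTS.
Qed.

Lemma unif_nE n (F : seq R -> \bar R) (G : n.-tuple mR -> \bar R) :
  (forall l : n.-tuple mR, in_box l -> F l = G l) ->
  measurable_fun setT G -> (forall l, 0 <= G l)%E ->
  unif_n n F = (\int[power_prob uniform11 n]_l G l)%E.
Proof.
elim: n F G => [|n IH] F G FG mG G0.
  by rewrite integral_dirac// diracT mul1e -FG.
rewrite ge0_integral_power_probS//; apply: unif1E.
- move=> y y1; apply: IH => [l l1||l] //.
  + rewrite -FG// => z; rewrite inE => /predU1P[->//|]; exact: l1.
  + apply: measurableT_comp => //; apply: measurableT_comp; first exact: measurable_tcons.
    exact: measurable_fun_pair.
- apply: (measurable_fun_fubini_tonelli_F (G \o @tcons _ mR n)) => [|p].
    exact: measurableT_comp.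
  exact: G0.
- by move=> y; apply: integral_ge0 => l _; exact: G0.
Qed.

Lemma unif_circleE (F : pt -> \bar R) (G : mR -> \bar R) :
  (forall phi, F (theta_of phi) = G phi) ->
  measurable_fun setT G -> (forall phi, 0 <= G phi)%E ->
  unif_circle F = (\int[angle_prob R]_phi G phi)%E.
Proof.
move=> FG mG G0; rewrite [RHS]integral_uniform// -ge0_integralZl//.
- rewrite subr0 -integral_itv_bndo_bndc; last first.
    by apply: measurable_funTS; exact: measurable_funeM.
  by apply: eq_integral => y _; rewrite FG.
- exact: measurable_funTS.
- by rewrite lee_fin invr_ge0 subr0 ltW// two_pi_gt0.
Qed.

Lemma unif_sampleE n (F : pt -> seq R -> \bar R)
    (f : sample R n -> \bar R) :
  (forall phi (l : n.-tuple mR), in_box l ->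
     F (theta_of phi) l = (\int[uniform11]_z f ((phi, l), z))%E) ->
  measurable_fun setT f -> (forall w, 0 <= f w)%E ->
  unif_circle (fun th => unif_n n (F th)) = (\int[sample_prob R n]_w f w)%E.
Proof.
move=> Ff mf f0; rewrite ge0_integral_sample_prob//.
apply: unif_circleE => [phi||phi].
- apply: unif_nE => [l l1||l]; first exact: Ff.
    exact: measurable_integral_side.
  exact: integral_ge0.
- exact: measurable_integral_breakpoints_side.
- by apply: integral_ge0 => l _; exact: integral_ge0.
Qed.

Lemma size_breakpoints a : size (breakpoints a) = (size a).+2.
Proof. by rewrite /= size_rcons size_sort. Qed.

Lemma in_box_breakpoints a : in_box a -> in_box (breakpoints a).
Proof.
move=> a1 y; rewrite in_cons mem_rcons in_cons mem_sort => /or3P[/eqP->|/eqP->|/a1//]; lra.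
Qed.

Lemma sorted_breakpoints a : in_box a -> sorted <=%R (breakpoints a).
Proof.
move=> a1; have [ge_N1 le_1] : all (>= -1) a /\ all (<= 1) a.
  by split; apply/allP => y /a1 /andP[].
rewrite (sorted_pairwise le_trans)/= all_rcons pairwise_rcons !all_sort ge_N1 le_1.
by rewrite -(sorted_pairwise le_trans) sort_sorted ?andbT //=; lra.
Qed.

Lemma count_breakpoints (p : pred R) a :
  count p (breakpoints a) = (p (-1)%R + count p a + p 1%R)%N.
Proof. by rewrite /breakpoints/= -cats1 count_cat count_sort /= addn0 addnA. Qed.

Lemma piece_cell n a t : size a = n -> in_box a -> piece n.+1 a t = cell n a t.
Proof.
move=> an a1; rewrite /piece /cell; have [/andP[N1t t1]|t11] := ifPn; last first.
  case: pickP => // i /andP[it ti]; have nth_in_box k : (k < n.+2)%N ->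
      -1 <= nth 0 (breakpoints a) k <= 1.
    by move=> kn; apply: (in_box_breakpoints a1); rewrite mem_nth// size_breakpoints an.
  have /andP[lo _] := nth_in_box i (ltnW (ltn_ord i)).
  have /andP[_ hi] := nth_in_box i.+1 (ltn_ord i).
  by rewrite (le_lt_trans lo it) (le_trans ti hi) in t11.
have cn : (count (< t) a < n.+1)%N by rewrite ltnS -an count_size.
have nthE k : (k < n.+2)%N ->
    (nth 0 (breakpoints a) k < t) = (k < (count (< t) a).+1)%N.
  move=> kn; rewrite nth_lt_count ?size_breakpoints ?an//; last exact: sorted_breakpoints.
  by rewrite count_breakpoints/= N1t ltNge t1/= addn0.
rewrite (_ : [pick i | _] = [pick i : 'I_n.+1 | count (< t) a == i]).
  case: pickP => [i /eqP ->|/(_ (inord (count (< t) a)))]; first by rewrite inord_val.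
  by rewrite inordK ?eqxx.
apply: eq_pick => i; rewrite [X in _ && X]leNgt !nthE ?ltnS ?leq_ord ?(ltnW (ltn_ord i))//.
by rewrite -leqNgt andbC eqn_leq.
Qed.

Section Distributions.
Variables (n m : nat) (x : 'I_m -> pt) (v : {ffun 'I_m -> bool}).
Implicit Types (phi z : R) (b : {ffun 'I_n.+1 -> bool}) (i : 'I_m).

Lemma bitv_inj : injective bitv.
Proof.
have N11 : 1 <> -1 :> R by lra.
move=> [] [] bc; [exact: erefl|case: (N11 bc)|case: (N11 (esym bc))|exact: erefl].
Qed.

Lemma bitvM_sgn c t : bitv c * sgn t = bitv (c (+) ~~ (0 <= t)).
Proof. by rewrite /bitv /sgn; case: c; case: ifP; rewrite ?mulrNN ?mulr1 ?mul1r. Qed.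

Lemma dot_theta_perp (p : pt) phi : dot p (theta_perp (theta_of phi)) = proj (rot p) phi.
Proof. exact/esym/proj_rot. Qed.

Lemma fD1_answer phi (a : n.-tuple R) b i : in_box a ->
  fD1 (theta_of phi) a b (x i) = bitv (answer b (pieces n x phi a i) true).
Proof.
move=> a1; rewrite /fD1 piece_cell ?size_tuple// /pieces -[dot _ _]/(proj (x i) phi).
by case: (cell _ _ _) => //= k; rewrite addbF.
Qed.

Lemma gD2_answer phi (a : n.-tuple R) b z i : in_box a ->
  gD2 (theta_of phi) a b z (x i) =
  bitv (answer b (pieces n x phi a i) (sides x phi z i)).
Proof.
move=> a1; rewrite /gD2 piece_cell ?size_tuple// /pieces.
rewrite -[dot _ (theta_of _)]/(proj (x i) phi).
by case: (cell _ _ _) => [k|//]; rewrite dot_theta_perp; exact: bitvM_sgn.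
Qed.

Lemma indic_forall_signvec (f : 'I_m -> R) (g : 'I_m -> bool) :
  (forall i, f i = bitv (g i)) ->
  Defs.indic [forall i, f i == signvec v i] = ([forall i, g i == v i]%:R%:E)%E.
Proof.
move=> fg; rewrite (_ : [forall i, _] = [forall i, g i == v i]).
  by rewrite /Defs.indic; case: [forall i, _].
by apply: eq_forallb => i; rewrite fg (inj_eq bitv_inj).
Qed.

Lemma answer_pmf_unif_bits K S : (answer_pmf R K S v)%:E = unif_bits (fun b =>
  ([forall i, answer b (K i) (S i) == v i]%:R)%:E).
Proof. by rewrite /unif_bits sumEFin -EFinM /answer_pmf card_ord. Qed.

Lemma probD1E : probD1 n.+1 x v = (\int[sample_prob R n]_w (lawD1 x w v)%:E)%E.
Proof.
apply: (@unif_sampleE n) => [phi a a1||w].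
- rewrite -[LHS](integral_cst_prob uniform11); apply: eq_integral => z _.
  rewrite /lawD1 answer_pmf_unif_bits; congr (_ * _)%E; apply: eq_bigr => b _.
  by apply: indic_forall_signvec => i; exact: fD1_answer.
- by apply/measurable_EFinP; exact: measurable_lawD1.
- by rewrite lee_fin; apply: (proj1 (is_pmf_lawD1 x w)).
Qed.

Lemma probD2E : probD2 n.+1 x v = (\int[sample_prob R n]_w (lawD2 x w v)%:E)%E.
Proof.
apply: (@unif_sampleE n) => [phi a a1||w].
- rewrite integral_lawD2_section; congr (_ * _)%E; apply: eq_bigr => b _.
  apply: unif1E => [z _||z] //.
    by apply: indic_forall_signvec => i; exact: gD2_answer.
  by apply/measurable_EFinP; apply: measurable_fun_natb; exact: measurable_answer_section.
- by apply/measurable_EFinP; exact: measurable_lawD2.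
- by rewrite lee_fin; apply: (proj1 (is_pmf_lawD2 x w)).
Qed.

End Distributions.

Theorem theorem5p2 :
  exists C : R, forall (s : nat), (2 <= s)%N ->
    forall (m : nat) (x : 'I_m -> pt),
      ((m%:R : R) <= (s%:R : R) `^ (10^-1)) ->
      (tv_D1_D2 s x <= (C * (s%:R : R) `^ (- 10^-1))%:E)%E.
Proof.
exists (64 / cos 1 + 4) => -[//|[//|n]] _ m x mq.
set s : R := n.+2%:R in mq *; pose tau : R := s `^ (- 2^-1).
have s1 : 1 <= s by rewrite ler1n.
have tau0 : 0 < tau by apply: powR_gt0; apply: lt_le_trans s1.
rewrite /tv_D1_D2; under eq_bigr do rewrite probD1E probD2E.
apply: (le_trans (tv_laws_le x (ltn0Sn n) tau0)); rewrite lee_fin card_ord.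
apply: (@le_trans _ _ (m%:R ^+ 2 * ((64 / cos 1 + 4) * tau))).
  by rewrite ler_wpM2l ?sqr_ge0// [leRHS]mulrDl lerD2l div_powRNhalf_le.
rewrite mulrCA ler_wpM2l ?sqr_mul_powRNhalf_le//.
by rewrite addr_ge0// divr_ge0// ltW// cos1_gt0.
Qed.
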